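(* Consider the system $x_{t+1}=f(x_t,u_t,w_t)$, $y_t=h(x_t)$ with $f:\mathcal{X}\times\mathcal{U}\times\mathcal{W}\to\mathcal{X}$, $h:\mathcal{X}\to\mathcal{Y}$, $\mathcal{Y}=h(\mathcal{X})$, stage cost $l:\mathcal{X}\times\mathcal{U}\times\mathcal{W}\to\mathbb{R}$, and the class of causal strategies. Assume that $\sup_{w\in\mathcal{W}}l(x,u,w)\ge 0$ for all $x\in\mathcal{X},u\in\mathcal{U}$, and that for every $y\in\mathcal{Y}$ the preimage $h^{-1}\{y\}$ is an indexed set of at most $M$ elements. Let the update $g$, the Bellman operators $\mathcal{B}_u,\mathcal{B}$ and the value iteration $V_0,V_1,\ldots$ be as defined in the context. Assume that there exist a function $\bar V:(\mathbb{R}\cup\{-\infty\})^M\times\mathcal{Y}\to\mathbb{R}$ and a stationary information-state feedback strategy $\bar\pi=(\bar\eta,\bar\eta,\ldots)$, $\bar\eta:(\mathbb{R}\cup\{-\infty\})^M\times\mathcal{Y}\to\mathcal{U}$, such that $\bar V\ge V_0$ and $$\mathcal{B}_{\bar\eta(\mathbf{r},y)}\bar V(\mathbf{r},y)\le\bar V(\mathbf{r},y)$$ for all $\mathbf{r}$ and $y$. Then the value iteration $V_0,V_1,\ldots$ is bounded, and $J_{\bar\mu}(y_0)\le\bar V(0,y_0)$ for the policy $\bar\mu_t(y_0,\dots,y_t,u_0,\dots,u_{t-1})=\bar\eta(\mathbf{r}_t,y_t)$, where $\mathbf{r}_0=0$ and $\mathbf{r}_{t+1}=g(\mathbf{r}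_t,y_{t+1},y_t,u_t)$.
   Context: A causal strategy is a sequence $\mu=(\mu_0,\mu_1,\dots)$ with $u_t=\mu_t(y_0,\dots,y_t,u_0,\dots,u_{t-1})\in\mathcal{U}$. For such a strategy and $y_0\in\mathcal{Y}$, $$J_\mu^N(y_0)=\sup\Big\{\sum_{t=0}^N l(x_t,u_t,w_t): w_0,\dots,w_N\in\mathcal{W},\ x_0\in\mathcal{X},\ h(x_0)=y_0\Big\},\qquad J_\mu(y_0)=\sup_N J_\mu^N(y_0),$$ with $x_t,y_t,u_t$ generated by the system and $\mu$. Information state update: for each $y\in\mathcal{Y}$ fix an enumeration $\xi^1(y),\dots,\xi^M(y)$ of $h^{-1}\{y\}$ (repetitions allowed if there are fewer than $M$ elements). For $\mathbf{r}=(r^1,\dots,r^M)\in(\mathbb{R}\cup\{-\infty\})^M$, $v,y\in\mathcal{Y}$, $u\in\mathcal{U}$, define $g(\mathbf{r},v,y,u)=(g_1,\dots,g_M)$ by $$g_i=\sup\{\,l(\xi^j(y),u,w)+r^j:\ j\in\{1,\dots,M\},\ w\in\mathcal{W},\ \xi^i(v)=f(\xi^j(y),u,w)\,\},$$ with $\sup\emptyset=-\infty$. It is implicit that $g$ takes values in $(\mathbb{R}\cup\{-\infty\})^M$. Bellman operators: for (extended) real-valued functions $V$ on $(\mathbb{R}\cup\{-\infty\})^M\times\mathcal{Y}$, $$\mathcal{B}_uV(\mathbf{r},y)=\sup_{v\in\mathcal{Y}}V(g(\mathbf{r},v,y,u),v),\qquad \mathcal{B}V(\mathbf{r},y)=\inf_{u\in\mathcal{U}}\mathcal{B}_uV(\mathbf{r},y).$$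 Value iteration: $V_0(\mathbf{r},y)=\max_{i=1,\dots,M}r^i$, $V_{k+1}=\mathcal{B}V_k$. Boundedness of the sequence is understood pointwise: for each $(\mathbf{r},y)$ the values $V_k(\mathbf{r},y)$, $k\ge0$, are bounded above by a real number. Inequalities between functions are pointwise; the $0$ in $\bar V(0,y_0)$ is the zero vector. *)

(* Defs.v *)
From mathcomp Require Import all_boot all_order all_algebra.
From mathcomp Require Import all_classical all_reals all_analysis.

Set Implicit Arguments.
Unset Strict Implicit.
Unset Printing Implicit Defensive.

Import Order.TTheory GRing.Theory Num.Theory.
Local Open Scope classical_set_scope.
Local Open Scope ring_scope.
Local Open Scope ereal_scope.

(* The set R \cup {-oo}, as a subtype of the extended reals. *)
Definition lreal (R : realType) : Type := {x : \bar R | x < +oo}.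

Definition infostate (R : realType) (M : nat) : Type := 'I_M -> lreal R.

Definition infostate0 (R : realType) (M : nat) : infostate R M :=
  fun=> exist _ (0%R : R)%:E (ltry 0%R).
Arguments infostate0 : clear implicits.

(* The i-th component of the information state update.  Each r^j is below +oo
   and l is real, so the sum is never of the form oo - oo; but the supremum may
   be +oo, hence the codomain. *)
Definition update_val (R : realType) (M : nat) (X U W Y : Type)
    (f : X -> U -> W -> X) (l : X -> U -> W -> R) (xi : Y -> 'I_M -> X)
    (r : infostate R M) (v y : Y) (u : U) (i : 'I_M) : \bar R :=
  ereal_sup [set z | exists (j : 'I_M) (w : W),
    xi v i = f (xi y j) u w /\ z = (l (xi y j) u w)%:E + sval (r j)].

Definition update_proper (R : realType) (M : nat) (X U W Y : Type)
    (f : X -> U -> W -> X) (l : X -> U -> W -> R) (xi : Y -> 'I_M -> X) : Prop :=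
  forall r v y u i, update_val f l xi r v y u i < +oo.

Definition update (R : realType) (M : nat) (X U W Y : Type)
    (f : X -> U -> W -> X) (l : X -> U -> W -> R) (xi : Y -> 'I_M -> X)
    (gP : update_proper f l xi)
    (r : infostate R M) (v y : Y) (u : U) : infostate R M :=
  fun i => exist _ (update_val f l xi r v y u i) (gP r v y u i).

Definition bellman_at (R : realType) (M : nat) (U Y : Type)
    (g : infostate R M -> Y -> Y -> U -> infostate R M) (u : U)
    (V : infostate R M -> Y -> \bar R) (r : infostate R M) (y : Y) : \bar R :=
  ereal_sup (range (fun v : Y => V (g r v y u) v)).

Definition bellman (R : realType) (M : nat) (U Y : Type)
    (g : infostate R M -> Y -> Y -> U -> infostate R M)
    (V : infostate R M -> Y -> \bar R) (r : infostate R M) (y : Y) : \bar R :=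
  ereal_inf (range (fun u : U => bellman_at g u V r y)).

Definition value0 (R : realType) (M : nat) (Y : Type)
    (r : infostate R M) (y : Y) : \bar R :=
  \big[maxe/-oo]_(i < M) sval (r i).

Definition value_iter (R : realType) (M : nat) (U Y : Type)
    (g : infostate R M -> Y -> Y -> U -> infostate R M) (k : nat) :
    infostate R M -> Y -> \bar R :=
  iter k (bellman g) (@value0 R M Y).

(* The component mu t maps (y_0, ..., y_t) and (u_0, ..., u_(t-1)) to u_t. *)
Definition causal_strategy (U Y : Type) : Type :=
  forall t : nat, ('I_t.+1 -> Y) -> ('I_t -> U) -> U.

(* Only the values w 0, ..., w N are constrained, x being followed up to time
   N + 1 and u up to time N. *)
Definition closed_loop (X U W Y : Type)
    (f : X -> U -> W -> X) (h : X -> Y) (mu : causal_strategy U Y) (N : nat)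
    (x : nat -> X) (u : nat -> U) (w : nat -> W) : Prop :=
  forall t : nat, (t <= N)%N ->
    u t = mu t (fun i : 'I_t.+1 => h (x i)) (fun i : 'I_t => u i) /\
    x t.+1 = f (x t) (u t) (w t).

Definition JN (R : realType) (X U W Y : Type)
    (f : X -> U -> W -> X) (h : X -> Y) (l : X -> U -> W -> R)
    (mu : causal_strategy U Y) (N : nat) (y0 : Y) : \bar R :=
  ereal_sup [set c | exists (x : nat -> X) (u : nat -> U) (w : nat -> W),
    [/\ closed_loop f h mu N x u w, h (x 0%N) = y0 &
        c = (\sum_(0 <= t < N.+1) l (x t) (u t) (w t))%R%:E]].

Definition J (R : realType) (X U W Y : Type)
    (f : X -> U -> W -> X) (h : X -> Y) (l : X -> U -> W -> R)
    (mu : causal_strategy U Y) (y0 : Y) : \bar R :=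
  ereal_sup (range (fun N : nat => JN f h l mu N y0)).

(* r_t as a function of (y_0, ..., y_t) and (u_0, ..., u_(t-1)), through
   r_0 = 0 and r_(t+1) = g(r_t, y_(t+1), y_t, u_t). *)
Fixpoint info_of_history (R : realType) (M : nat) (U Y : Type)
    (g : infostate R M -> Y -> Y -> U -> infostate R M) (t : nat) :
    ('I_t.+1 -> Y) -> ('I_t -> U) -> infostate R M :=
  match t with
  | 0 => fun _ _ => infostate0 R M
  | s.+1 => fun ys us =>
      g (info_of_history g (fun i : 'I_s.+1 => ys (widen_ord (leqnSn s.+1) i))
           (fun i : 'I_s => us (widen_ord (leqnSn s) i)))
        (ys ord_max) (ys (widen_ord (leqnSn s.+1) ord_max)) (us ord_max)
  end.

Definition feedback_policy (R : realType) (M : nat) (U Y : Type)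
    (g : infostate R M -> Y -> Y -> U -> infostate R M)
    (eta : infostate R M -> Y -> U) : causal_strategy U Y :=
  fun t ys us => eta (info_of_history g ys us) (ys ord_max).

(* Main.v *)
Require Import Defs.
From mathcomp Require Import all_boot all_order all_algebra.
From mathcomp Require Import all_classical all_reals all_analysis.

(** The function [Vbar] is a supersolution of the Bellman equation, certified
    by the feedback [eta], and both conclusions come from comparing with it.

    Boundedness of the value iteration: the Bellman operator is monotone, and
    its infimum over controls is at most its value at the control [eta r y], so
    it maps every function below [Vbar] to a function below [Vbar].  As [V_0] is
    below [Vbar], so are all iterates ([value_iter_le_supersolution]).

    Performance bound: along a closed-loop trajectory [r_t] is determined by
    the measured signals.  Two facts are combined.
    - [past_cost_le_infostate]: [r_t] is a worst case over all
      histories compatible with the measurements, with one component for each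
      possible current state.  The true history is one of these, so the cost
      incurred so far is at most the component of the true state, hence at most
      [V_0 (r_t, y_t)].
    - [supersolution_along_closed_loop]: the next measurement is one of the [v]
      in the supremum defining the Bellman operator, so the supersolution
      inequality makes [Vbar (r_t, y_t)] nonincreasing in [t].
    Hence the cost over the stages [0, ..., N] is at most
    [V_0 (r_(N+1), y_(N+1)) <= Vbar (r_(N+1), y_(N+1)) <= Vbar (0, y_0)], for
    every disturbance, every initial state compatible with [y_0], and every
    horizon [N]. *)

Set Implicit Arguments.
Unset Strict Implicit.
Unset Printing Implicit Defensive.

Import Order.TTheory GRing.Theory Num.Theory.
Local Open Scope classical_set_scope.
Local Open Scope ring_scope.
Local Open Scope ereal_scope.

Lemma bellman_at_le (R : realType) (M : nat) (U Y : Type)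
    (g : infostate R M -> Y -> Y -> U -> infostate R M) (u : U)
    (V1 V2 : infostate R M -> Y -> \bar R) (r : infostate R M) (y : Y) :
  (forall r' y', V1 r' y' <= V2 r' y') ->
  bellman_at g u V1 r y <= bellman_at g u V2 r y.
Proof.
move=> V12; apply: ge_ereal_sup => _ [v _ <-].
by apply: le_trans (V12 _ _) _; apply: ereal_sup_ubound; exists v.
Qed.

Lemma value_iter_le_supersolution (R : realType) (M : nat) (U Y : Type)
    (g : infostate R M -> Y -> Y -> U -> infostate R M)
    (V : infostate R M -> Y -> \bar R) (eta : infostate R M -> Y -> U) :
  (forall r y, value0 r y <= V r y) ->
  (forall r y, bellman_at g (eta r y) V r y <= V r y) ->
  forall k r y, value_iter g k r y <= V r y.
Proof.
move=> V0le Vbell; elim=> [|k IH] r y; first exact: V0le.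
apply: le_trans (Vbell r y); apply: le_trans (bellman_at_le _ _ _ _ IH).
by apply: ereal_inf_lbound; exists (eta r y).
Qed.

(** Feeding [info_of_history] with prefixes of infinite signals removes the
    ordinal-indexed histories: the recursion of [r_t] then holds by
    conversion. *)
Definition info_at (R : realType) (M : nat) (U Y : Type)
    (g : infostate R M -> Y -> Y -> U -> infostate R M)
    (y : nat -> Y) (u : nat -> U) (t : nat) : infostate R M :=
  info_of_history g (fun i : 'I_t.+1 => y i) (fun i : 'I_t => u i).

Lemma info_atS (R : realType) (M : nat) (U Y : Type)
    (g : infostate R M -> Y -> Y -> U -> infostate R M)
    (y : nat -> Y) (u : nat -> U) (t : nat) :
  info_at g y u t.+1 = g (info_at g y u t) (y t.+1) (y t) (u t).
Proof. by []. Qed.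

(** Each step only uses the inequality at the measurement that occurs, one of
    those over which [bellman_at] takes the supremum. *)
Lemma supersolution_along_closed_loop (R : realType) (M : nat) (U Y : Type)
    (g : infostate R M -> Y -> Y -> U -> infostate R M)
    (V : infostate R M -> Y -> \bar R) (eta : infostate R M -> Y -> U)
    (y : nat -> Y) (u : nat -> U) (N : nat) :
  (forall r y', bellman_at g (eta r y') V r y' <= V r y') ->
  (forall t, (t < N)%N -> u t = eta (info_at g y u t) (y t)) ->
  V (info_at g y u N) (y N) <= V (infostate0 R M) (y 0%N).
Proof.
move=> Vbell; elim: N => [//|N IH] uE.
have {}IH := IH (fun t ltN => uE t (ltnW ltN)).
apply: le_trans IH; apply: le_trans (Vbell _ _).
by rewrite info_atS uE //; apply: ereal_sup_ubound; exists (y N.+1).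
Qed.

(** The index [j] with [xi (y_t) j = x_t] has to be carried along the
    induction: the true pair of current state and disturbance is then one of
    those over which the next component of the update takes its supremum. *)
Lemma past_cost_le_infostate (R : realType) (X U W Y : Type) (M : nat)
    (f : X -> U -> W -> X) (h : X -> Y) (l : X -> U -> W -> R)
    (xi : Y -> 'I_M -> X) (g_proper : update_proper f l xi)
    (x : nat -> X) (u : nat -> U) (w : nat -> W) (N : nat) :
  (forall y, h @^-1` [set y] `<=` range (xi y)) ->
  (forall t, (t < N)%N -> x t.+1 = f (x t) (u t) (w t)) ->
  exists2 j : 'I_M, xi (h (x N)) j = x N &
    (\sum_(0 <= t < N) l (x t) (u t) (w t))%R%:E <=
      sval (info_at (update g_proper) (h \o x) u N j).
Proof.
move=> xi_onto; elim: N => [|N IH] xE.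
  have [j _ jE] := xi_onto (h (x 0%N)) _ (erefl (h (x 0%N))).
  by exists j => //; rewrite big_geq.
have [j jE cost_le] := IH (fun t ltN => xE t (ltnW ltN)).
have [i _ iE] := xi_onto (h (x N.+1)) _ (erefl (h (x N.+1))).
exists i => //; rewrite info_atS big_nat_recr //= EFinD addeC.
apply: le_trans (leeD2l _ cost_le) _.
by apply: ereal_sup_ubound; exists j, (w N); rewrite iE jE xE.
Qed.

Lemma le_value0 (R : realType) (M : nat) (Y : Type) (r : infostate R M)
    (y : Y) (i : 'I_M) : sval (r i) <= value0 r y.
Proof. exact: (le_bigmax_cond _ (fun i => sval (r i))). Qed.

Theorem theorem6 (R : realType) (X U W Y : Type) (M : nat)
    (f : X -> U -> W -> X) (h : X -> Y) (l : X -> U -> W -> R)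
    (h_onto : range h = [set: Y])
    (l_sup_ge0 : forall (x : X) (u : U),
       0 <= ereal_sup (range (fun w : W => (l x u w)%:E)))
    (xi : Y -> 'I_M -> X)
    (xi_enum : forall y : Y, range (xi y) = h @^-1` [set y])
    (g_proper : update_proper f l xi)
    (Vbar : infostate R M -> Y -> R)
    (eta : infostate R M -> Y -> U)
    (Vbar_ge : forall (r : infostate R M) (y : Y),
       value0 r y <= (Vbar r y)%:E)
    (Vbar_bellman : forall (r : infostate R M) (y : Y),
       bellman_at (update g_proper) (eta r y) (fun r' y' => (Vbar r' y')%:E) r y
         <= (Vbar r y)%:E) :
  (forall (r : infostate R M) (y : Y),
     exists C : R, forall k : nat, value_iter (update g_proper) k r y <= C%:E) /\
  (forall y0 : Y,
     J f h l (feedback_policy (update g_proper) eta) y0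
       <= (Vbar (infostate0 R M) y0)%:E).
Proof.
split=> [r y|y0].
  exists (Vbar r y) => k.
  exact: (value_iter_le_supersolution Vbar_ge Vbar_bellman).
apply: ge_ereal_sup => _ [N _ <-].
apply: ge_ereal_sup => _ [x [u [w [loop <- ->]]]].
have xi_onto y : h @^-1` [set y] `<=` range (xi y) by rewrite xi_enum.
(* The state, and with it the measurement, is defined up to time N + 1, so the
   comparison can be made once all the stage costs 0, ..., N are incurred. *)
have [j _ cost_le] := past_cost_le_infostate g_proper xi_onto
  (fun t (ltN : (t < N.+1)%N) => proj2 (loop t ltN)).
apply: le_trans cost_le _; apply: le_trans (le_value0 _ (h (x N.+1)) _) _.
apply: le_trans (Vbar_ge _ _) _.
exact: (supersolution_along_closed_loop (y := h \o x) Vbar_bellman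
  (fun t (ltN : (t < N.+1)%N) => proj1 (loop t ltN))).
Qed.
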